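(* Let $G=(V,E)$ be a connected graph, let $l:E\to\mathbb{R}_{>0}$ be a length function, and let $\Gamma$ be the metric graph associated to $(G,l)$. Then there is a subdivision $H$ of $G$ such that $\operatorname{gon}(\Gamma)\geq\operatorname{gon}(H)$.
   Context: Graphs are finite and undirected, with nonempty vertex set; parallel edges are allowed, loops are not. A subdivision of $G$ is a graph obtained from $G$ by replacing edges by paths of length at least $1$ with new, distinct interior vertices ($G$ itself is a subdivision of $G$). Gonality of a graph. Let $H$ be a connected graph with vertex set $W$. Its Laplacian $Q(H)\in\mathbb{Z}^{W\times W}$ has diagonal entries the vertex degrees and, for $u\ne v$, $Q_{uv}=-(\text{number of edges between } u \text{ and } v)$. A divisor on $H$ is a vector $D\in\mathbb{Z}^W$, of degree $\sum_{v}D(v)$, effective if $D\ge 0$; $D\sim D'$ if $D-D'=Q(H)x$ for some $x\in\mathbb{Z}^W$. $D$ has positive rank if for every $v\in W$ there is an effective divisor $D''\sim D$ with $D''(v)\ge 1$. $\operatorname{gon}(H)$ is the minimum degree of a divisor on $H$ of positive rank. Gonality of a metric graph. The metric graph $\Gamma$ associated to $(G,l)$ is the compact connected metric space obtained by identifying each edge $e=\{u,v\}$ with a segment of length $l(e)$ joining $u$ and $v$. A divisor on $\Gamma$ is an element $D=c_1v_1+\cdots+c_kv_k$ of the free abelian group on the points of $\Gamma$; its degree is $c_1+\cdots+c_k$, and it is effective if all coefficients are nonnegative. For a continuous piecewise linear function $f$ on $\Gamma$ with integral slopes, $\operatorname{div}(f)=\sum_{v\in\Gamma}c_v v$, where $c_v$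 is the sum of the outgoing slopes of $f$ at $v$. Two divisors on $\Gamma$ are equivalent if their difference is of the form $\operatorname{div}(f)$. A divisor $D$ covers a point $s\in\Gamma$ if there is an effective divisor equivalent to $D$ with $s$ in its support. $\operatorname{gon}(\Gamma)$ is the minimum degree of a divisor that covers every point of $\Gamma$. *)

(* Defs.v *)
From HB Require Import structures.
From mathcomp Require Import all_boot all_order all_algebra.
From mathcomp.multinomials Require Import freeg.
From mathcomp Require Import boolp classical_sets reals topology normedtype.
Set Implicit Arguments.
Unset Strict Implicit.
Unset Printing Implicit Defensive.
Import Order.TTheory GRing.Theory Num.Theory.
Import numFieldNormedType.Exports.
Local Open Scope classical_set_scope.
Local Open Scope ring_scope.

(* Finite loopless multigraphs. The order of the two ends [src e], [tgt e] is
   a reference orientation only: every notion for graphs below is symmetric in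
   the two ends. *)
Record multigraph := Multigraph {
  vert : finType;
  edge : finType;
  src : edge -> vert;
  tgt : edge -> vert;
  src_neq_tgt : forall e, src e != tgt e;
  vert_gt0 : (0 < #|vert|)%N
}.

Section Graphs.
Variable G : multigraph.

Definition links (e : edge G) (u v : vert G) : bool :=
  (src e == u) && (tgt e == v) || (src e == v) && (tgt e == u).

Definition connected_graph : Prop :=
  forall u v : vert G, connect (fun x y => [exists e, links e x y]) u v.

Definition degree (u : vert G) : nat :=
  #|[pred e : edge G | (src e == u) || (tgt e == u)]|.

Definition laplacian (u v : vert G) : int :=
  if u == v then (degree u)%:Z
  else - (#|[pred e : edge G | links e u v]|)%:Z.

Definition gdivisor := {ffun vert G -> int}.

Definition gdeg (D : gdivisor) : int := \sum_v D v.

Definition geffective (D : gdivisor) : Prop := forall v, 0 <= D v.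

Definition gequiv (D D' : gdivisor) : Prop :=
  exists x : {ffun vert G -> int},
    forall u, D u - D' u = \sum_v laplacian u v * x v.

Definition positive_rank (D : gdivisor) : Prop :=
  forall v, exists D' : gdivisor, [/\ geffective D', gequiv D' D & 1 <= D' v].

End Graphs.

(* The minimum of a set of integers; the value 0 is a default, used only when
   the set has no minimum. *)
Definition min_int (S : set int) : int :=
  xget 0 [set m | S m /\ forall n, S n -> m <= n].

Definition gonality (G : multigraph) : int :=
  min_int [set d | exists2 D : gdivisor G, positive_rank D & gdeg D = d].

Section Subdivision.
Variables (G : multigraph) (n : edge G -> nat).

(* Edge [e] becomes a path with [n e] new interior vertices, hence with
   [(n e).+1] edges. Up to isomorphism every subdivision of [G] is obtained in
   this way. *)
Definition subdiv_vert : finType := (vert G + {e : edge G & 'I_(n e)})%type.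
Definition subdiv_edge : finType := {e : edge G & 'I_(n e).+1}.

(* The vertices number 0, ..., (n e).+1 of the path that replaces [e]; number 0
   is [src e] and number (n e).+1 is [tgt e]. *)
Definition path_vertex (e : edge G) (i : nat) : subdiv_vert :=
  if i is j.+1 then
    if insub j is Some k then inr (@Tagged _ e (fun e => 'I_(n e)) k)
    else inl (tgt e)
  else inl (src e).

Definition subdiv_src (a : subdiv_edge) : subdiv_vert :=
  path_vertex (tag a) (tagged a).
Definition subdiv_tgt (a : subdiv_edge) : subdiv_vert :=
  path_vertex (tag a) (tagged a).+1.

Lemma subdiv_src_neq_tgt a : subdiv_src a != subdiv_tgt a.
Proof.
case: a => e [i ilt]; rewrite /subdiv_src /subdiv_tgt /=.
case: i ilt => [|j] jlt /=.
  case: insubP => [k _ _|_] //.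
  by apply/eqP => -[] /eqP; apply/negP; exact: src_neq_tgt.
case: insubP => [k _ kj|]; last by rewrite (jlt : (j < n e)%N).
case: insubP => [k' _ k'j|_] //.
apply/eqP => -[] /eqP; rewrite -tag_eqE /tag_eq /= eqxx tagged_asE /= => /eqP kk'.
by move: kj; rewrite kk' k'j => /eqP; rewrite gtn_eqF.
Qed.

Lemma subdiv_vert_gt0 : (0 < #|subdiv_vert|)%N.
Proof.
by case/card_gt0P: (vert_gt0 G) => v _; apply/card_gt0P; exists (inl v).
Qed.

Definition subdivide : multigraph :=
  Multigraph subdiv_src_neq_tgt subdiv_vert_gt0.

End Subdivision.

(* The points of the metric graph: the segments [0, l e] glued at their end
   points are the disjoint union of the vertices and of the open segments. *)
Definition mpoint (R : realType) (G : multigraph) (l : edge G -> R) : Type :=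
  (vert G + {e : edge G & {t : R | 0 < t < l e}})%type.

HB.instance Definition _ (R : realType) (G : multigraph) (l : edge G -> R) :=
  Choice.copy (mpoint l) (vert G + {e : edge G & {t : R | 0 < t < l e}})%type.

Section MetricGraph.
Variables (R : realType) (G : multigraph) (l : edge G -> R).
Implicit Types (e : edge G) (x y z : mpoint l).

(* The point at distance [t] from [src e] on the segment of [e], for [t] in
   [0, l e]; clamped outside this interval. *)
Definition seg e (t : R) : mpoint l :=
  if insub t is Some u
  then inr (@Tagged _ e (fun e => {t : R | 0 < t < l e}) u)
  else if t <= 0 then inl (src e) else inl (tgt e).

(* [mwalk x y L]: there is a path of length [L] from [x] to [y], made of moves
   along segments. The distance of [x] and [y] is the infimum of these lengths,
   hence is smaller than [r] if and only if [mball x r y]. *)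
Inductive mwalk : mpoint l -> mpoint l -> R -> Prop :=
| MwalkNil x : mwalk x x 0
| MwalkCons e s t y L : 0 <= s <= l e -> 0 <= t <= l e ->
    mwalk (seg e t) y L -> mwalk (seg e s) y (`|s - t| + L).

Lemma mwalk_cat x y z L M : mwalk x y L -> mwalk y z M -> mwalk x z (L + M).
Proof.
elim=> {x y L} [x|e s t y L hs ht _ IH] w; first by rewrite add0r.
by rewrite -addrA; apply: MwalkCons => //; exact: IH.
Qed.

Lemma mwalk_sym x y L : mwalk x y L -> mwalk y x L.
Proof.
elim=> {x y L} [x|e s t y L hs ht _ IH]; first exact: MwalkNil.
rewrite addrC; apply: (mwalk_cat IH); rewrite distrC -[X in mwalk _ _ X]addr0.
by apply: MwalkCons => //; exact: MwalkNil.
Qed.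

Definition mball x (r : R) : set (mpoint l) :=
  [set y | exists2 L, mwalk x y L & L < r].

Lemma mball_center x (r : R) : 0 < r -> mball x r x.
Proof. by exists 0 => //; exact: MwalkNil. Qed.

Lemma mball_sym x y (r : R) : mball x r y -> mball y r x.
Proof. by case=> L w Lr; exists L => //; exact: mwalk_sym. Qed.

Lemma mball_triangle x y z (r s : R) :
  mball x r y -> mball y s z -> mball x (r + s) z.
Proof.
case=> L w Lr [M w' Ms]; exists (L + M); [exact: mwalk_cat w w'|exact: ltrD].
Qed.

Definition mentourage : set_system (mpoint l * mpoint l) := entourage_ mball.

HB.instance Definition _ := hasNbhs.Build (mpoint l) (nbhs_ mentourage).
HB.instance Definition _ := @Nbhs_isPseudoMetric.Build R (mpoint l)
  mentourage erefl mball mball_center mball_sym mball_triangle erefl.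

(* [g] is piecewise linear on [[a, b]] with integral slopes; [s] lists the end
   points, other than [a], of the pieces. *)
Definition pl_integral (g : R -> R) (a b : R) : Prop :=
  exists s : seq R, [/\ path <%R a s, last a s = b &
    forall i, (i < size s)%N -> exists c : int,
      forall t, nth a (a :: s) i <= t <= nth a s i ->
        g t = g (nth a (a :: s) i) + c%:~R * (t - nth a (a :: s) i)].

Definition rational_function (f : mpoint l -> R) : Prop :=
  continuous f /\ forall e, pl_integral (f \o seg e) 0 (l e).

(* The slopes of [f] at the point [seg e t], in the directions towards [tgt e]
   and towards [src e]. *)
Definition slope_fwd (f : mpoint l -> R) e (t : R) : R :=
  lim (h^-1 * (f (seg e (t + h)) - f (seg e t)) @[h --> 0^'+]).
Definition slope_bwd (f : mpoint l -> R) e (t : R) : R :=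
  lim (h^-1 * (f (seg e (t - h)) - f (seg e t)) @[h --> 0^'+]).

Definition sum_outgoing_slopes (f : mpoint l -> R) x : R :=
  match x with
  | inl v => \sum_(e | src e == v) slope_fwd f e 0
             + \sum_(e | tgt e == v) slope_bwd f e (l e)
  | inr p => slope_fwd f (tag p) (val (tagged p))
             + slope_bwd f (tag p) (val (tagged p))
  end.

Definition mdivisor := {freeg (mpoint l) / int}.

Definition meffective (D : mdivisor) : Prop := forall x, 0 <= coeff x D.

Definition is_div (f : mpoint l -> R) (D : mdivisor) : Prop :=
  forall x, (coeff x D)%:~R = sum_outgoing_slopes f x.

Definition mequiv (D D' : mdivisor) : Prop :=
  exists2 f : mpoint l -> R, rational_function f & is_div f (D - D').

Definition covers (D : mdivisor) x : Prop :=
  exists D' : mdivisor, [/\ meffective D', mequiv D' D & x \in dom D'].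

Definition metric_gonality : int :=
  min_int [set d | exists2 D : mdivisor, forall x, covers D x & deg D = d].

End MetricGraph.

(* Main.v *)
(* A function realising an equivalence on the metric graph has finitely many
   breakpoints, so finitely many reals are involved: edge lengths, positions of
   chips and breakpoints, and values of the functions. These can be replaced by
   integers in the same order satisfying the same integral linear relations. The
   integral edge lengths define the subdivision, the divisor moves to it, and the
   functions become integral potentials, which shows that the divisor still
   covers every vertex of the original graph. By a discrete version of Luo's
   theorem it then covers every vertex of the subdivision: if an interior vertex
   of a path has no chip in any effective representative, then going from a
   representative that covers one end of the path to one that covers the other
   end passes through a representative with chips on both sides of that vertex,
   and these can be slid onto it. *)
Require Import Defs.
From mathcomp Require Import all_boot all_order all_algebra.
From mathcomp.multinomials Require Import freeg.
From mathcomp Require Import boolp classical_sets reals topology normedtype.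
From mathcomp Require Import zify ring lra.
Set Implicit Arguments.
Unset Strict Implicit.
Unset Printing Implicit Defensive.
Import Order.TTheory GRing.Theory Num.Theory.
Import numFieldNormedType.Exports.
Local Open Scope classical_set_scope.
Local Open Scope ring_scope.

(** * Laplacian and legal firings *)

Section Laplacian.
Variable G : multigraph.
Implicit Types (x y z : vert G -> int) (u v : vert G) (D E : gdivisor G).

Definition lap x u : int := \sum_v laplacian u v * x v.

(** Without loops, each edge at [u] contributes to exactly one of the two sums. In this edgewise
    form [lap] depends only on differences along edges, so inequalities can be checked edge by
    edge. *)
Lemma lapE x u :
  lap x u = \sum_(a | src a == u) (x u - x (tgt a))
          + \sum_(a | tgt a == u) (x u - x (src a)).
Proof.
have deg_sum : (degree u)%:Z * x u =
    \sum_(a | src a == u) x u + \sum_(a | tgt a == u) x u.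
  rewrite /degree -natz -sum1_card natr_sum mulr_suml big_mkcond.
  rewrite [X in _ = X + _]big_mkcond [X in _ = _ + X]big_mkcond -big_split /=.
  apply: eq_bigr => a _; rewrite inE.
  have := src_neq_tgt a; case: (src a =P u) => [->|_]; case: (tgt a =P u) => [->|_];
    by rewrite ?eqxx //= ?mul1r ?addr0 ?add0r.
have links_sum :
    \sum_(v | v != u) (#|[pred a : edge G | links a u v]|)%:Z * x v =
    \sum_(a | src a == u) x (tgt a) + \sum_(a | tgt a == u) x (src a).
  under eq_bigr => v vu.
    rewrite -natz -sum1_card natr_sum mulr_suml big_mkcond /=.
    over.
  rewrite exchange_big /= [in RHS]big_mkcond [X in _ = _ + X]big_mkcond.
  rewrite -big_split /=; apply: eq_bigr => a _.
  have := src_neq_tgt a.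
  case: (src a =P u) => [su|su]; case: (tgt a =P u) => [tu|tu];
      rewrite ?su ?tu ?eqxx //= => nst.
  - rewrite (bigD1 (tgt a)) 1?eq_sym //= inE /links su !eqxx /= mul1r big1 ?addr0 //.
    move=> v /andP [vu vt]; rewrite inE /links su eqxx /= eq_sym (negPf vt) /=.
    by rewrite (eq_sym u) (negPf vu).
  - rewrite (bigD1 (src a)) //= inE /links tu !eqxx orbT /= mul1r big1 ?addr0 ?add0r //.
    move=> v /andP [vu vt]; rewrite inE /links tu eqxx /= (eq_sym (src a) v) (negPf vt) /=.
    by rewrite (eq_sym u) (negPf vu) andbF.
  - rewrite big1 ?addr0 // => v vu; rewrite inE /links.
    by move/eqP/negPf: su => ->; move/eqP/negPf: tu => ->; rewrite andbF.
rewrite !sumrB addrACA -opprD -links_sum -deg_sum /lap (bigD1 u) //=.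
rewrite {1}/laplacian eqxx -sumrN; congr (_ + _); apply: eq_bigr => v vu.
by rewrite /laplacian eq_sym (negPf vu) mulNr.
Qed.

Lemma lapD x y u : lap (fun v => x v + y v) u = lap x u + lap y u.
Proof. by rewrite -big_split /=; apply: eq_bigr => v _; rewrite mulrDr. Qed.

Lemma lapN x u : lap (fun v => - x v) u = - lap x u.
Proof. by rewrite -sumrN; apply: eq_bigr => v _; rewrite mulrN. Qed.

Lemma lap_const (c : int) u : lap (fun=> c) u = 0.
Proof. by rewrite lapE !big1 ?addr0 // => *; rewrite subrr. Qed.

Lemma eq_lap x y : x =1 y -> lap x =1 lap y.
Proof. by move=> xy u; apply: eq_bigr => v _; rewrite xy. Qed.

Lemma lap_sub_le x y u : (forall v, x u - x v <= y u - y v) -> lap x u <= lap y u.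
Proof. by move=> xy; rewrite !lapE lerD // ler_sum. Qed.

Lemma lap_max_ge0 x u : (forall v, x v <= x u) -> 0 <= lap x u.
Proof.
move=> xu; rewrite -(lap_const 0 u); apply: lap_sub_le => v.
by rewrite subrr subr_ge0.
Qed.

Lemma sum_lap x : \sum_u lap x u = 0.
Proof.
under eq_bigr do rewrite lapE big_mkcond [X in _ + X]big_mkcond /= -big_split /=.
rewrite exchange_big /= big1 // => a _.
rewrite big_split -!big_mkcond /= (big_pred1 (src a)) => [|v]; last exact: eq_sym.
rewrite (big_pred1 (tgt a)) => [|v]; last exact: eq_sym.
by rewrite -opprB addNr.
Qed.

(** The sign is chosen so that [x u] counts how often [u] fires, each firing sending one chip along
    every edge at [u]. *)
Lemma gequivP D E : gequiv D E <-> exists x, forall u, D u = E u - lap x u.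
Proof.
split=> [[x Dx]|[x Dx]].
  exists (fun u => - x u) => u; rewrite lapN opprK -[lap _ _]Dx; ring.
exists [ffun u => - x u] => u; rewrite Dx addrC addrA addNr add0r -lapN.
by apply: eq_bigr => v _; rewrite ffunE.
Qed.

Lemma gequiv_deg D E : gequiv D E -> gdeg D = gdeg E.
Proof.
case/gequivP=> x Dx; rewrite /gdeg (eq_bigr _ (fun u _ => Dx u)) sumrB sum_lap.
by rewrite subr0.
Qed.

Lemma gequiv_sym D E : gequiv D E -> gequiv E D.
Proof.
move=> /gequivP [x Dx]; apply/gequivP; exists (fun u => - x u) => u.
by rewrite lapN Dx opprK subrK.
Qed.

Lemma gequiv_trans E D D' : gequiv D E -> gequiv E D' -> gequiv D D'.
Proof.
move=> /gequivP [x Dx] /gequivP [y Ey]; apply/gequivP.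
by exists (fun u => y u + x u) => u; rewrite lapD Dx Ey opprD addrA.
Qed.

(** Cutting a firing script off below at 0 keeps [u] out of debt: if [x u] is nonnegative, [u] loses
    no more than under [x]; otherwise [u] does not fire and can only gain. *)
Lemma lap_max_le x D u :
  geffective D -> 0 <= D u - lap x u ->
  0 <= D u - lap (fun v => Num.max (x v) 0) u.
Proof.
move=> D0 Dx; have [xu|xu] := leP 0 (x u).
  apply: (le_trans Dx); rewrite lerD2l lerN2; apply: lap_sub_le => v.
  by rewrite (max_idPl xu) lerD2l lerN2 le_max lexx.
apply: (le_trans (D0 u)); rewrite -[leLHS]subr0 lerD2l lerN2.
rewrite -[leRHS](lap_const 0 u); apply: lap_sub_le => v.
by rewrite subrr subr_le0 /= (max_idPr (ltW xu)) le_max lexx orbT.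
Qed.

(* A legal firing script that fires [u] maximally often fires its neighbours
   equally often if [u] has no chip. *)
Lemma lap_max_spread x D u v :
  geffective D -> (forall v, 0 <= D v - lap x v) -> (forall v, x v <= 0) ->
  x u = 0 -> D u = 0 ->
  (exists a : edge G, src a = u /\ tgt a = v \/ src a = v /\ tgt a = u) -> x v = 0.
Proof.
move=> D0 Dx x0 xu Du [a auv]; apply/eqP; rewrite eq_le x0 leNgt /=.
apply/negP => xv; have := Dx u; rewrite Du sub0r oppr_ge0 lapE leNgt.
case/negP; rewrite xu.
have S1 : 0 <= \sum_(a | src a == u) (0 - x (tgt a)).
  by apply: sumr_ge0 => b _; rewrite sub0r oppr_ge0.
have S2 : 0 <= \sum_(a | tgt a == u) (0 - x (src a)).
  by apply: sumr_ge0 => b _; rewrite sub0r oppr_ge0.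
case: auv => -[au av].
  apply: ltr_wpDr => //; rewrite (bigD1 a) ?au //= av.
  rewrite ltr_pwDl ?sub0r ?oppr_gt0 //.
  by apply: sumr_ge0 => b _; rewrite sub0r oppr_ge0.
apply: ltr_wpDl => //; rewrite (bigD1 a) ?av //= au.
rewrite ltr_pwDl ?sub0r ?oppr_gt0 //.
by apply: sumr_ge0 => b _; rewrite sub0r oppr_ge0.
Qed.

End Laplacian.

Local Arguments path_vertex : simpl never.

(** * Divisors on subdivisions *)

Section SubdivisionLaplacian.
Variables (G : multigraph) (n : edge G -> nat).
Local Notation H := (subdivide n).
Local Notation pv := (path_vertex n).
Implicit Types (e : edge G) (x : vert H -> int).

Lemma path_vertex_first e : pv e 0 = inl (src e).
Proof. by []. Qed.

Lemma path_vertex_inner e j (jn : (j < n e)%N) :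
  pv e j.+1 = inr (@Tagged _ e (fun e => 'I_(n e)) (Ordinal jn)).
Proof.
rewrite /path_vertex; case: insubP => [k _ kj|]; last by rewrite jn.
by congr (inr (Tagged _ _)); apply: val_inj.
Qed.

Lemma path_vertex_last e : pv e (n e).+1 = inl (tgt e).
Proof. by rewrite /path_vertex insubF ?ltnn. Qed.

Lemma path_vertex_eq_inl e j w : (j <= (n e).+1)%N ->
  (pv e j == inl w) =
  (j == 0) && (src e == w) || (j == (n e).+1) && (tgt e == w).
Proof.
case: j => [|j] jn; first by rewrite path_vertex_first orbF.
rewrite ltnS in jn; rewrite eqSS; case: (ltngtP j (n e)) jn => // [jlt _|-> _].
  by rewrite path_vertex_inner.
by rewrite path_vertex_last.
Qed.

Lemma path_vertex_eq_inner e e' i j :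
  (0 < i < (n e).+1)%N -> (j <= (n e').+1)%N ->
  (pv e' j == pv e i) = (e' == e) && (j == i).
Proof.
case: i => // i /= ilt; case: j => [|j] jlt.
  by rewrite (path_vertex_inner ilt) path_vertex_first andbF.
rewrite ltnS leq_eqVlt in jlt; rewrite (path_vertex_inner ilt) eqSS.
case/predU1P: jlt => [->|jlt].
  rewrite path_vertex_last; apply/esym/negP => /andP [/eqP ee /eqP ni]; subst e'.
  by rewrite -ni ltnn in ilt.
rewrite path_vertex_inner.
apply/eqP/andP => [[] ee|[/eqP ee /eqP ji]].
  by move=> k; split; apply/eqP; [|case: k].
subst e' j; congr (inr (Tagged _ _)); exact: val_inj.
Qed.

Lemma sum_subdivide_edge (P : pred (edge H)) (F : edge H -> int) :
  \sum_(a | P a) F a =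
  \sum_e \sum_(i < (n e).+1 | P (@Tagged _ e (fun e => 'I_(n e).+1) i))
     F (@Tagged _ e (fun e => 'I_(n e).+1) i).
Proof.
rewrite (sig_big_dep (J := fun e => 'I_(n e).+1) xpredT
  (fun e i => P (@Tagged _ e (fun e => 'I_(n e).+1) i))
  (fun e i => F (@Tagged _ e (fun e => 'I_(n e).+1) i))) /=.
by apply: eq_big => -[].
Qed.

(** No case distinction on [n e] is needed: for [n e = 0] the neighbours [pv e 1] and [pv e (n e)]
    are [tgt e] and [src e] themselves. *)
Lemma lap_inl x w :
  lap x (inl w) = \sum_(e | src e == w) (x (inl w) - x (pv e 1))
                + \sum_(e | tgt e == w) (x (inl w) - x (pv e (n e))).
Proof.
rewrite lapE !sum_subdivide_edge; congr (_ + _); rewrite [in RHS]big_mkcond /=;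
  apply: eq_bigr => e _; rewrite /subdiv_src /subdiv_tgt /=.
- rewrite big_mkcond big_ord_recl big1 => [|i _] /=.
    by rewrite addr0 path_vertex_eq_inl //= orbF.
  rewrite path_vertex_eq_inl; last by rewrite /bump /= add1n ltnS ltnW.
  by rewrite /bump /= add1n eqSS (ltn_eqF (ltn_ord i)).
- rewrite big_mkcond big_ord_recr big1 => [|i _] /=.
    by rewrite add0r path_vertex_eq_inl //= eqxx.
  rewrite path_vertex_eq_inl; last by rewrite ltnS ltnW.
  by rewrite eqSS (ltn_eqF (ltn_ord i)).
Qed.

Lemma lap_inner x e i : (0 < i < (n e).+1)%N ->
  lap x (pv e i) = x (pv e i) *+ 2 - x (pv e i.-1) - x (pv e i.+1).
Proof.
move=> ilt; rewrite lapE !sum_subdivide_edge /= /subdiv_src /subdiv_tgt.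
have pvS e' (k : 'I_(n e').+1) : (k <= (n e').+1)%N by exact: ltnW.
rewrite (bigD1 e) //= [X in _ + X + _ = _]big1 => [|e' ee']; last first.
  by rewrite big_pred0 // => k; rewrite path_vertex_eq_inner // (negPf ee').
rewrite [X in _ + X = _](bigD1 e) //= [X in _ + (_ + X) = _]big1 => [|e' ee']; last first.
  by rewrite big_pred0 // => k; rewrite path_vertex_eq_inner // (negPf ee').
have i1 : (i.-1 < (n e).+1)%N by lia.
have i2 : (i < (n e).+1)%N by lia.
rewrite (big_pred1 (Ordinal i2)) => [|k]; last first.
  by rewrite path_vertex_eq_inner // eqxx.
rewrite (big_pred1 (Ordinal i1)) => [|k]; last first.
  rewrite path_vertex_eq_inner ?eqxx //=.
  apply/eqP/eqP => [ki|->]; first by apply: val_inj; rewrite /= -ki.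
  by rewrite /= prednK //; lia.
by rewrite /= mulr2n; ring.
Qed.

End SubdivisionLaplacian.

(** * Sliding chips along subdivided edges, and rank-determining vertices *)

Section SubdivisionRank.
Variables (G : multigraph) (n : edge G -> nat).
Local Notation H := (subdivide n).
Local Notation pv := (path_vertex n).
Implicit Types (e : edge G) (D E : gdivisor H).

Definition gcovers D (p : vert H) : Prop :=
  exists E, [/\ geffective E, gequiv E D & 1 <= E p].

Lemma path_vertex_edge e i : (i < (n e).+1)%N ->
  exists a : edge H, src a = pv e i /\ tgt a = pv e i.+1.
Proof.
by move=> ilt; exists (@Tagged _ e (fun e => 'I_(n e).+1) (Ordinal ilt)).
Qed.

Section Spread.
Variables (D : gdivisor H) (x : vert H -> int) (e : edge G).
Hypotheses (D_ge0 : geffective D) (Dx_ge0 : forall p, 0 <= D p - lap x p).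
Hypothesis x_le0 : forall p, x p <= 0.

(** The maximal value 0 of the script propagates by [lap_max_spread], one vertex at a time, as long
    as the vertices passed carry no chip. *)
Lemma path_spread_fwd i k : (i + k <= (n e).+1)%N -> x (pv e i) = 0 ->
  (forall j, (i <= j < i + k)%N -> D (pv e j) = 0) -> x (pv e (i + k)) = 0.
Proof.
elim: k => [|k IH] ik xi Dj; first by rewrite addn0.
have xik : x (pv e (i + k)) = 0 by apply: IH => // [|j jlt]; [|apply: Dj]; lia.
apply: (@lap_max_spread _ x D (pv e (i + k))) => //; first by apply: Dj; lia.
have [|a [sa ta]] := @path_vertex_edge e (i + k); first by lia.
by exists a; left; rewrite addnS.
Qed.

Lemma path_spread_bwd i k : (i + k <= (n e).+1)%N -> x (pv e (i + k)) = 0 ->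
  (forall j, (i < j <= i + k)%N -> D (pv e j) = 0) -> x (pv e i) = 0.
Proof.
elim: k => [|k IH] ik xi Dj; first by rewrite addn0 in xi.
apply: IH => // [||j jlt]; [lia| |by apply: Dj; lia].
apply: (@lap_max_spread _ x D (pv e (i + k.+1))) => //; first by apply: Dj; lia.
have [|a [sa ta]] := @path_vertex_edge e (i + k); first by lia.
by exists a; right; rewrite addnS.
Qed.

Lemma chip_at_max p : x p = 0 -> D p - lap x p <= D p.
Proof.
move=> xp; rewrite gerBl lap_max_ge0 // => q.
by rewrite xp.
Qed.

(** If positions 0 to [m] carried no chip, the value 0 would spread from [m] back to position 0. A
    vertex where the script is maximal gains no chip, so position 0 would still be empty after
    firing. *)
Lemma chip_before m : (m <= (n e).+1)%N -> x (pv e m) = 0 ->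
  1 <= D (pv e 0) - lap x (pv e 0) ->
  exists2 j, (j <= m)%N & 1 <= D (pv e j).
Proof.
move=> mn xm D0; apply: contrapT => noj.
have Dj j : (j <= m)%N -> D (pv e j) = 0.
  move=> jm; apply/eqP; rewrite eq_le D_ge0 andbT leNgt; apply/negP => Dj.
  by apply: noj; exists j.
have x0 : x (pv e 0) = 0 by apply: (@path_spread_bwd 0 m) => // j /andP [_]; exact: Dj.
by have := le_trans D0 (chip_at_max x0); rewrite Dj.
Qed.

(** Mirror image of [chip_before], with the value 0 spreading towards [tgt e]. *)
Lemma chip_after m : (m <= (n e).+1)%N -> x (pv e m) = 0 ->
  1 <= D (pv e (n e).+1) - lap x (pv e (n e).+1) ->
  exists2 j, (m <= j <= (n e).+1)%N & 1 <= D (pv e j).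
Proof.
move=> mn xm Dn; apply: contrapT => noj.
have Dj j : (m <= j <= (n e).+1)%N -> D (pv e j) = 0.
  move=> jm; apply/eqP; rewrite eq_le D_ge0 andbT leNgt; apply/negP => Dj.
  by apply: noj; exists j.
have mk : (m + ((n e).+1 - m) = (n e).+1)%N by lia.
have xn : x (pv e (n e).+1) = 0.
  by rewrite -mk; apply: path_spread_fwd; rewrite ?mk // => j jlt; apply: Dj; lia.
by have := le_trans Dn (chip_at_max xn); rewrite Dj // mn leqnn.
Qed.

End Spread.

(** The successor converts the index of an interior vertex into its number on the path. *)
Definition interval_indicator e i j (p : vert H) : int :=
  match p with
  | inl _ => 0
  | inr q => ((tag q == e) && (i < (tagged q).+1 < j)%N)%:Z
  end.

Lemma interval_indicatorE e i j e' k : (j <= (n e).+1)%N -> (k <= (n e').+1)%N ->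
  interval_indicator e i j (pv e' k) = ((e' == e) && (i < k < j)%N)%:Z.
Proof.
move=> jn; case: k => [|k]; first by rewrite path_vertex_first /= andbF.
rewrite ltnS leq_eqVlt => /predU1P [->|kn]; last by rewrite path_vertex_inner.
rewrite path_vertex_last /=; case: eqP => //= ee; subst e'.
by case: andP => // -[_]; lia.
Qed.

(* Firing the complement of the open interval moves one chip inwards from each
   of its two ends. *)
Lemma slide_chips D e i j : (i.+1 < j <= (n e).+1)%N -> geffective D ->
  1 <= D (pv e i) -> 1 <= D (pv e j) ->
  exists E, [/\ geffective E, gequiv E D, 1 <= E (pv e i.+1) & 1 <= E (pv e j.-1)].
Proof.
move=> /andP [ij jn] D0 Di Dj.
pose b := interval_indicator e i j.
have bE e' k : (k <= (n e').+1)%N -> b (pv e' k) = ((e' == e) && (i < k < j)%N)%:Z.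
  by move=> kn; exact: interval_indicatorE.
exists [ffun p => D p + lap b p].
have inner k : (0 < k < (n e).+1)%N -> lap b (pv e k) =
    (i < k < j)%N%:Z *+ 2 - (i < k.-1 < j)%N%:Z - (i < k.+1 < j)%N%:Z.
  by move=> kn; rewrite lap_inner // !bE ?eqxx //; lia.
split.
- case=> [w|[e' k]]; rewrite ffunE.
    rewrite lap_inl big_mkcond [X in _ + (_ + X)]big_mkcond /=.
    have S1 e' : e' != e -> (if src e' == w then b (inl w) - b (pv e' 1) else 0) = 0.
      by move=> ee; rewrite bE // (negPf ee) subr0; case: ifP.
    have S2 e' : e' != e ->
        (if tgt e' == w then b (inl w) - b (pv e' (n e')) else 0) = 0.
      by move=> ee; rewrite bE // (negPf ee) subr0; case: ifP.
    rewrite (bigD1 e) //= [X in _ + (_ + X + _)]big1 // addr0.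
    rewrite (bigD1 e) //= [X in _ + (_ + (_ + X))]big1 // addr0.
    rewrite !bE // !eqxx /= !sub0r.
    (* As [e] is not a loop, [w] is at most one of its ends and loses at most one chip. It loses one
       only if [i = 0] or [j = (n e).+1] places it at an end of the interval, where a chip is
       available. *)
    have nst := src_neq_tgt e; have := D0 (inl w).
    case: eqP => [sw|_].
      rewrite sw in nst; rewrite eq_sym (negPf nst) addr0.
      case: (ltnP i 1) => [i0|_]; last by rewrite /= oppr0 addr0.
      have i00 : i = 0%N by lia.
      move: Di; rewrite i00 path_vertex_first sw => Dw _; rewrite subr_ge0.
      by apply: le_trans Dw; case: (1 < j)%N.
    case: eqP => [tw|_]; last by rewrite !addr0.
    case: (ltnP (n e) j) => [i0|_]; last by rewrite andbF oppr0 !addr0.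
    have i00 : j = (n e).+1 by lia.
    move: Dj; rewrite i00 path_vertex_last tw => Dw _; rewrite add0r subr_ge0.
    by apply: le_trans Dw; case: (_ && _).
  have -> : inr (existT _ e' k) = pv e' k.+1 :> vert H.
    by rewrite path_vertex_inner //; congr (inr (Tagged _ _)); apply: val_inj.
  have := D0 (pv e' k.+1); have kn := ltn_ord k.
  have [ee|ee] := eqVneq e' e; last first.
    by rewrite lap_inner // !bE ?(negPf ee) /= ?mul0rn ?subr0 ?addr0 //; lia.
  subst e'; rewrite inner //=.
  have [ki|ki] := eqVneq k.+1 i.
    by rewrite ki; move: Di; set d : int := D _; lia.
  have [kj|kj] := eqVneq k.+1 j.
    by rewrite kj; move: Dj; set d : int := D _; lia.
  by set d : int := D _; lia.
- by apply/gequivP; exists (fun p => - b p) => p; rewrite ffunE lapN opprK.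
- rewrite ffunE inner; last by lia.
  by have := D0 (pv e i.+1); set d : int := D _; lia.
- rewrite ffunE inner; last by lia.
  by have := D0 (pv e j.-1); set d : int := D _; lia.
Qed.

(** Induction on [j - i]: each slide brings both chips one step closer, until one of them reaches
    [m]. *)
Lemma gcovers_between D e i m j :
  (i < m < j)%N -> (j <= (n e).+1)%N -> geffective D ->
  1 <= D (pv e i) -> 1 <= D (pv e j) -> gcovers D (pv e m).
Proof.
have [k] := ubnP (j - i); elim: k => // k IH in D i j * => jik imj jn D0 Di Dj.
have [|E [E0 ED Ei Ej]] := @slide_chips D e i j _ D0 Di Dj; first by lia.
have [mi|mi] := eqVneq m i.+1; first by subst m; exists E.
have [mj|mj] := eqVneq m j.-1; first by subst m; exists E.
have [|||F [F0 FE Fm]] := IH E i.+1 j.-1 _ _ _ E0 Ei Ej; try lia.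
by exists F; split=> //; exact: gequiv_trans FE ED.
Qed.

(* Luo: the vertices of a loopless graph form a rank-determining set. *)
Lemma positive_rank_subdivide D :
  (forall w : vert G, gcovers D (inl w)) -> positive_rank D.
Proof.
move=> Dw [w|[e k]]; first exact: Dw.
have kn := ltn_ord k; set m := (k : nat).+1.
have -> : inr (existT _ e k) = pv e m :> vert H.
  by rewrite path_vertex_inner //; congr (inr (Tagged _ _)); apply: val_inj.
apply: contrapT => nocov.
have {}nocov E : gequiv E D -> ~ gcovers E (pv e m).
  by move=> ED [F [F0 FE Fm]]; apply: nocov; exists F; split=> //; exact: gequiv_trans FE ED.
have [D1 [D10 D1D D1s]] := Dw (src e); have [D2 [D20 D2D D2t]] := Dw (tgt e).
have /gequivP [x D12] := gequiv_trans D2D (gequiv_sym D1D).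
(* The script from [D1] to [D2] is cut at its level at [m]: firing [y] leads from [D1] to an
   effective [E], and [z] leads on to [D2]. Seen from [E], both [- y] (back to [D1]) and [z] are
   nonpositive and vanish at [m], as [chip_before] and [chip_after] require. *)
pose y p := Num.max (x p - x (pv e m)) 0.
pose z p := Num.min (x p - x (pv e m)) 0.
have lap_shift p : lap (fun p => x p - x (pv e m)) p = lap x p.
  by rewrite lapD lap_const addr0.
have lap_yz p : lap x p = lap y p + lap z p.
  rewrite -lapD -lap_shift; apply: eq_lap => q; rewrite /y /z; lia.
pose E : gdivisor H := [ffun p => D1 p - lap y p].
have E0 : geffective E.
  by move=> p; rewrite ffunE; apply: lap_max_le => //; rewrite lap_shift -D12.
have ED1 : gequiv E D1 by apply/gequivP; exists y => p; rewrite ffunE.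
have D1E p : D1 p = E p - lap (fun p => - y p) p by rewrite lapN ffunE; ring.
have D2E p : D2 p = E p - lap z p by rewrite ffunE D12 lap_yz opprD addrA.
have [|||||i im Ei] := @chip_before E (fun p => - y p) e E0 _ _ m.
- by move=> p; rewrite -D1E.
- by move=> p; rewrite oppr_le0 le_max lexx orbT.
- by rewrite /m; lia.
- by rewrite /y subrr maxxx oppr0.
- by rewrite -D1E.
have [|||||j jm Ej] := @chip_after E z e E0 _ _ m.
- by move=> p; rewrite -D2E.
- by move=> p; rewrite ge_min lexx orbT.
- by rewrite /m; lia.
- by rewrite /z subrr minxx.
- by rewrite -D2E path_vertex_last.
(* A chip on [m] itself would cover it, so the two chips found lie strictly on either side of
   [m]. *)
have Em l : 1 <= E (pv e l) -> l != m.
  move=> El; apply/eqP => lm; apply: (nocov E (gequiv_trans ED1 D1D)).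
  exists E; split=> //; last by rewrite -lm.
  by apply/gequivP; exists (fun=> 0) => p; rewrite lap_const subr0.
have := Em _ Ei; have := Em _ Ej => mj mi.
apply: (nocov E (gequiv_trans ED1 D1D)).
by apply: (@gcovers_between E e i m j) => //; lia.
Qed.

End SubdivisionRank.

(** * Minima of sets of nonnegative integers, and gonality as such a minimum *)

Section Minimum.

(** By well-ordering of the naturals the minimum exists, so the default of [min_int] does not
    interfere. *)
Lemma min_intP (S : set int) d : S d -> (forall m, S m -> 0 <= m) ->
  S (min_int S) /\ forall m, S m -> min_int S <= m.
Proof.
move=> Sd S0; suff: exists m, S m /\ forall m', S m' -> m <= m'.
  by case=> m Sm; rewrite /min_int; apply: (@xgetPex _ 0 [set m | S m /\ forall n, S n -> m <= n]); exists m.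
have exP : exists k : nat, `[< S k%:Z >] by exists `|d|%N; apply/asboolP; rewrite gez0_abs ?S0.
have [k /asboolP Sk kmin] := ex_minnP exP; exists k%:Z; split=> // m Sm.
rewrite -(gez0_abs (S0 _ Sm)) lez_nat; apply: kmin; apply/asboolP.
by rewrite gez0_abs ?S0.
Qed.

End Minimum.

Section Gonality.
Variable G : multigraph.

Lemma positive_rank_deg_ge0 (D : gdivisor G) : positive_rank D -> 0 <= gdeg D.
Proof.
case/card_gt0P: (vert_gt0 G) => v _ /(_ v) [E [E0 ED _]].
by rewrite -(gequiv_deg ED); apply: sumr_ge0 => u _; exact: E0.
Qed.

Lemma gonality_le (D : gdivisor G) : positive_rank D -> gonality G <= gdeg D.
Proof.
move=> rD; have [||_] := @min_intP [set d | exists2 D : gdivisor G, positive_rank D & gdeg D = d] (gdeg D).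
- by exists D.
- by move=> _ [E rE <-]; exact: positive_rank_deg_ge0.
by apply; exists D.
Qed.

Lemma gonality_ge0 : 0 <= gonality G.
Proof.
pose S : set int := [set d | exists2 D : gdivisor G, positive_rank D & gdeg D = d].
(* One chip on every vertex shows that [S] is not empty. *)
have [||SG _] := @min_intP S (@gdeg G [ffun=> 1]).
- exists [ffun=> 1] => // v; exists [ffun=> 1]; split=> [u||]; rewrite ?ffunE //.
  by apply/gequivP; exists (fun=> 0) => u; rewrite lap_const subr0.
- by move=> _ [E rE <-]; exact: positive_rank_deg_ge0.
by case: SG => D rD; rewrite /gonality => <-; exact: positive_rank_deg_ge0.
Qed.

End Gonality.

(** * Integral models of finite sets of reals *)

Section IntegerModel.
Variable R : realType.

(* Adding a real [y] to [X]: either some integer relation expresses [y] through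
   [X], and then [theta y] is forced, or [theta y] may be any rational close to
   [y]. *)
Lemma rational_model (X : seq R) : uniq X -> forall eps : R, 0 < eps ->
  exists theta : R -> rat,
    (forall x, x \in X -> `|ratr (theta x) - x| < eps) /\
    forall c : R -> int, \sum_(x <- X) (c x)%:~R * x = 0 ->
      \sum_(x <- X) (c x)%:~R * theta x = 0.
Proof.
elim: X => [|y X IH] /=; first by move=> _ eps _; exists (fun=> 0); split=> // c; rewrite !big_nil.
move=> /andP [yX uX] eps eps0.
have upd (t : R -> rat) q x : x \in X -> (if x == y then q else t x) = t x.
  by move=> xX; rewrite ifN //; apply: contraNneq yX => <-.
have [[c0 [c0y rel0]]|norel] := pselect (exists c : R -> int,
    c y != 0 /\ \sum_(x <- y :: X) (c x)%:~R * x = 0); last first.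
  have [t [teps trel]] := IH uX _ eps0.
  have [q] := @rat_in_itvoo R (y - eps) (y + eps) ltac:(lra).
  rewrite in_itv /= => qy.
  exists (fun x => if x == y then q else t x); split=> [x|c].
    rewrite inE => /predU1P [->|xX]; first by rewrite eqxx ltr_distl.
    by rewrite upd // teps.
  have [cy rel|cy rel] := eqVneq (c y) 0; last by case: norel; exists c.
  rewrite big_cons cy mulr0z mul0r add0r big_seq.
  under eq_bigr => x xX do rewrite upd //.
  by rewrite -big_seq; apply: trel; rewrite -[RHS]rel big_cons cy mulr0z mul0r add0r.
pose C : R := \sum_(x <- X) `|(c0 x)%:~R|.
have C0 : 0 <= C by exact: sumr_ge0.
have c0y' : 0 < `|(c0 y)%:~R : R| by rewrite normr_gt0 intr_eq0.
(* The relation [c0] turns errors below [eps'] on [X] into an error of at most [C * eps'] divided by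
   the absolute value of [c0 y]. The summand 1 makes this strictly less than [eps] and keeps the
   denominator positive. *)
pose eps' := Num.min eps (`|(c0 y)%:~R| * eps / (C + 1)).
have eps'0 : 0 < eps'.
  by rewrite lt_min eps0 divr_gt0 ?mulr_gt0 //; lra.
have [t [teps trel]] := IH uX _ eps'0.
pose q : rat := - (\sum_(x <- X) (c0 x)%:~R * t x) / (c0 y)%:~R.
have c0yq : (c0 y)%:~R != 0 :> rat by rewrite intr_eq0.
have c0yR : (c0 y)%:~R != 0 :> R by rewrite intr_eq0.
exists (fun x => if x == y then q else t x); split=> [x|c rel].
  rewrite inE => /predU1P [->|xX]; last first.
    by rewrite upd //; apply: (lt_le_trans (teps _ xX)); rewrite ge_min lexx.
  rewrite eqxx -(ltr_pM2l c0y') -normrM mulrBr.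
  have -> : (c0 y)%:~R * ratr q = - \sum_(x <- X) (c0 x)%:~R * ratr (t x) :> R.
    rewrite /q fmorph_div /= rmorphN /= ratr_int mulrCA divff // mulr1.
    rewrite rmorph_sum /=; congr (- _); apply: eq_bigr => z _.
    by rewrite rmorphM /= ratr_int.
  have -> : (c0 y)%:~R * y = - \sum_(x <- X) (c0 x)%:~R * x.
    by apply/eqP; rewrite -addr_eq0; apply/eqP; rewrite -[RHS]rel0 big_cons.
  rewrite opprK addrC -sumrB; apply: (le_lt_trans (ler_norm_sum _ _ _)).
  apply: (@le_lt_trans _ _ (C * eps')).
    rewrite mulr_suml big_seq [leRHS]big_seq; apply: ler_sum => z zX.
    by rewrite -mulrBr normrM ler_wpM2l // distrC ltW // teps.
  apply: (@le_lt_trans _ _ (C * (`|(c0 y)%:~R| * eps / (C + 1)))).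
    by rewrite ler_wpM2l // ge_min lexx orbT.
  rewrite mulrA ltr_pdivrMr ?ltr_wpDl // mulrDr mulr1 (mulrC C) ltrDl.
  exact: mulr_gt0.
(* This combination of the relations [c] and [c0] eliminates [y], so the induction hypothesis for
   [X] applies to it. *)
have := trel (fun x => c0 y * c x - c y * c0 x).
have -> : \sum_(x <- X) (c0 y * c x - c y * c0 x)%:~R * x = 0.
  transitivity ((c0 y)%:~R * (\sum_(x <- y :: X) (c x)%:~R * x) -
                (c y)%:~R * (\sum_(x <- y :: X) (c0 x)%:~R * x)); last first.
    by rewrite rel rel0 !mulr0 subrr.
  rewrite !big_cons !mulrDr !mulr_sumr opprD addrACA -sumrB.
  rewrite mulrA [X in _ + - X + _](_ : _ = (c0 y)%:~R * (c y)%:~R * y) ?subrr ?add0r; last by ring.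
  by apply: eq_bigr => x _; rewrite rmorphB !rmorphM /=; ring.
move=> /(_ erefl) relX.
apply: (mulfI c0yq); rewrite mulr0 big_cons eqxx mulrDr -[RHS]relX.
rewrite [X in _ + _ * X]big_seq; under eq_bigr => x xX do rewrite upd //.
rewrite -big_seq /q mulrCA [X in _ * X]mulrCA divff // mulr1 mulrN mulr_sumr mulr_sumr.
rewrite addrC -sumrB; apply: eq_bigr => x _; rewrite rmorphB !rmorphM /=; ring.
Qed.

Lemma seq_pos_lower_bound (s : seq R) :
  exists2 eps : R, 0 < eps & forall x, x \in s -> 0 < x -> eps <= x.
Proof.
elim: s => [|y s [eps eps0 IH]]; first by exists 1.
have [y0|y0] := ltP 0 y; last first.
  by exists eps => // x; rewrite inE => /predU1P [->|/IH//]; lra.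
exists (Num.min y eps) => [|x]; first by rewrite lt_min y0.
by rewrite inE ge_min => /predU1P [->|/IH h /h ->]; rewrite ?lexx ?orbT.
Qed.

Lemma common_denominator (T : eqType) (s : seq T) (t : T -> rat) :
  exists2 N : int, 0 < N & forall x, x \in s -> exists k : int, N%:~R * t x = k%:~R.
Proof.
elim: s => [|y s [N N0 IH]]; first by exists 1.
exists (denq (t y) * N); first by rewrite mulr_gt0 // denq_gt0.
move=> x; rewrite inE rmorphM /= => /predU1P [->|/IH [k xk]].
  exists (N * numq (t y)); rewrite rmorphM /= numqE; ring.
by exists (denq (t y) * k); rewrite rmorphM /= -xk; ring.
Qed.

(** Rational approximations within half of a lower bound for the positive gaps of [X] keep the
    order. Multiplying by a positive common denominator makes them integers and preserves order and
    linear relations. *)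
Lemma integer_model (X : seq R) : exists theta : R -> int,
  {in X &, {homo theta : x y / x < y}} /\
  forall x y z w c, x \in X -> y \in X -> z \in X -> w \in X ->
    x - y = c%:~R * (z - w) -> theta x - theta y = c * (theta z - theta w).
Proof.
have [eps eps0 epsX] := seq_pos_lower_bound [seq y - x | x <- X, y <- X].
have [t [teps trel]] := rational_model (undup_uniq X) (divr_gt0 eps0 (ltr0Sn _ 1)).
have [N N0 NX] := common_denominator X t.
have thetaE x : x \in X -> (numq (N%:~R * t x))%:~R = N%:~R * t x.
  by move=> /NX [k ->]; rewrite numq_int.
exists (fun x => numq (N%:~R * t x)); split=> [x y xX yX xy|x y z w c xX yX zX wX rel].
  rewrite -(ltr_int rat) !thetaE // ltr_pM2l ?ltr0z // -(ltr_rat R).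
  have := teps _ (etrans (mem_undup X x) xX); have := teps _ (etrans (mem_undup X y) yX).
  have : eps <= y - x by apply: epsX; [apply/allpairsP; exists (x, y)|rewrite subr_gt0].
  by rewrite !ltr_distl => ? /andP[? ?] /andP[? ?]; lra.
have single (V : numFieldType) (f : R -> V) u : u \in X ->
    \sum_(v <- undup X) (v == u)%:R * f v = f u.
  move=> uX; rewrite (bigD1_seq u) ?mem_undup ?undup_uniq //= eqxx mul1r big1 ?addr0 //.
  by move=> v /negPf ->; rewrite mul0r.
(* Coefficients of the relation [x - y - c (z - w) = 0]. Sums of Kronecker deltas remain correct
   when some of the four points coincide. *)
pose d (v : R) : int := (v == x)%:R - (v == y)%:R - c * ((v == z)%:R - (v == w)%:R).
have sum_d (V : numFieldType) (f : R -> V) :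
    \sum_(v <- undup X) (d v)%:~R * f v = f x - f y - c%:~R * (f z - f w).
  rewrite -(single V f x) // -(single V f y) // -(single V f z) // -(single V f w) //.
  rewrite -!sumrB mulr_sumr -sumrB; apply: eq_bigr => v _.
  by rewrite /d !(rmorphB, rmorphM) /= !rmorph_nat; ring.
have := trel d; rewrite (sum_d R id) (sum_d rat t) /= rel subrr => /(_ erefl) trel0.
apply/eqP; rewrite -(eqr_int rat) rmorphM !rmorphB /= !thetaE //.
rewrite -!mulrBr mulrCA -subr_eq0 -mulrBr trel0 mulr0 //.
Qed.

End IntegerModel.

(** * From the metric graph to a subdivision *)

Section Slopes.
Variable R : realType.
Implicit Types (g : R -> R) (a b t : R).

Definition right_slope g t (c : R) :=
  exists2 d, 0 < d & forall h, 0 <= h <= d -> g (t + h) = g t + c * h.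

Definition left_slope g t (c : R) :=
  exists2 d, 0 < d & forall h, 0 <= h <= d -> g (t - h) = g t + c * h.

(** The factor [s] is 1 or -1 in the applications, so one computation serves both directions. *)
Lemma lim_slope g t c (s : R) :
  (exists2 d, 0 < d & forall h, 0 <= h <= d -> g (t + s * h) = g t + c * h) ->
  lim (h^-1 * (g (t + s * h) - g t) @[h --> 0^'+]) = c.
Proof.
case=> d d0 gd; apply/cvg_lim; first exact: norm_hausdorff.
apply: cvg_near_cst; near=> h.
have h0 : 0 < h by near: h; exact: nbhs_right_gt.
have hd : h < d by near: h; exact: nbhs_right_lt.
rewrite gd; last by rewrite !ltW.
by rewrite addrC addKr mulrCA mulVf ?mulr1 ?gt_eqF.
Unshelve. all: by end_near. Qed.

(** [seg] is clamped outside the segment, so functions can be compared on [[0, L]] only; the radius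
    is shrunk to stay inside. *)
Lemma right_slope_ext g g' (L : R) t c : 0 <= t < L ->
  (forall s, 0 <= s <= L -> g s = g' s) -> right_slope g' t c -> right_slope g t c.
Proof.
move=> tL gg [d d0 gd]; exists (Num.min d (L - t)) => [|h].
  by rewrite lt_min d0; lra.
by rewrite le_min => /and3P [h0 hd hL]; rewrite !gg ?gd ?h0 //; lra.
Qed.

Lemma left_slope_ext g g' (L : R) t c : 0 < t <= L ->
  (forall s, 0 <= s <= L -> g s = g' s) -> left_slope g' t c -> left_slope g t c.
Proof.
move=> tL gg [d d0 gd]; exists (Num.min d t) => [|h].
  by rewrite lt_min d0; lra.
by rewrite le_min => /and3P [h0 hd hL]; rewrite !gg ?gd ?h0 //; lra.
Qed.

Variables (G : multigraph) (l : edge G -> R).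
Implicit Types (f : mpoint l -> R) (e : edge G).

Lemma slope_fwdE f e t c : right_slope (f \o seg l e) t c -> slope_fwd f e t = c.
Proof.
move=> [d d0 gd]; rewrite -[RHS](@lim_slope (f \o seg l e) t c 1).
  by rewrite /slope_fwd /=; under eq_fun do rewrite -[X in t + X]mul1r.
by exists d => // h /gd; rewrite mul1r.
Qed.

Lemma slope_bwdE f e t c : left_slope (f \o seg l e) t c -> slope_bwd f e t = c.
Proof.
move=> [d d0 gd]; rewrite -[RHS](@lim_slope (f \o seg l e) t c (-1)).
  by rewrite /slope_bwd /=; under eq_fun do rewrite -[X in t + X]mulN1r.
by exists d => // h /gd; rewrite mulN1r.
Qed.

Definition linear_pieces g a (s : seq R) := forall i, (i < size s)%N ->
  exists c : int, forall t, nth a (a :: s) i <= t <= nth a s i ->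
    g t = g (nth a (a :: s) i) + c%:~R * (t - nth a (a :: s) i).

Lemma linear_pieces_cons g a b s : linear_pieces g a (b :: s) ->
  (exists c : int, forall t, a <= t <= b -> g t = g a + c%:~R * (t - a)) /\
  linear_pieces g b s.
Proof.
move=> gs; split; first exact: (gs 0%N).
move=> i si; have [c gc] := gs i.+1 si; exists c => t.
rewrite !(set_nth_default a) //; first exact: gc.
exact: ltnW.
Qed.

Lemma path_lt_last a s : path <%R a s -> a <= last a s.
Proof.
elim: s a => //= b s IH a /andP [ab /IH]; exact/le_trans/ltW.
Qed.

Section Interpolation.
Variables (theta : R -> int) (T X : seq R) (g : R -> R).
Hypothesis subTX : {subset T <= X}.
Hypothesis theta_mono : {in T &, {homo theta : x y / x < y}}.
Hypothesis theta_rel : forall x y z w c, x \in X -> y \in X -> z \in X -> w \in X ->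
  x - y = c%:~R * (z - w) -> theta x - theta y = c * (theta z - theta w).

(** [F] interpolates the values [theta (g b)] at the integers [theta b], for [b] in [a :: s]. The
    relation between the lengths and the increments of a piece survives [theta], so [F] has the same
    integral slopes as [g]. [T] holds positions, while [X] also holds values of [g]. *)
Lemma discrete_interpolation a s : path <%R a s -> linear_pieces g a s ->
  {subset a :: s <= T} -> {subset map g (a :: s) <= X} ->
  exists F : int -> int,
  [/\ F (theta a) = theta (g a),
      F (theta (last a s)) = theta (g (last a s)),
      forall t, t \in T -> a <= t < last a s -> exists2 c : int,
        right_slope g t c%:~R & F (theta t + 1) - F (theta t) = c,
      forall t, t \in T -> a < t <= last a s -> exists2 c : int,
        left_slope g t c%:~R & F (theta t - 1) - F (theta t) = c &
      forall j, theta a < j < theta (last a s) -> (forall t, t \in T -> theta t != j) ->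
        F (j + 1) - F j + (F (j - 1) - F j) = 0].
Proof.
elim: s a => [|b s IH] a /=.
  move=> _ _ _ _; exists (fun=> theta (g a)); split=> // [t|t|j]; last by lia.
    by move=> _; lra.
  by move=> _; lra.
move=> /andP [ab bs] /linear_pieces_cons [[c gc] gs] sT sX.
have [||F [Fb Flast Ffwd Fbwd Flin]] := IH b bs gs.
- by move=> t ts; apply: sT; rewrite inE ts orbT.
- by move=> t ts; apply: sX; rewrite inE ts orbT.
have aT : a \in T by apply: sT; rewrite mem_head.
have bT : b \in T by apply: sT; rewrite !inE eqxx orbT.
have lT : last b s \in T by apply: sT; rewrite inE mem_last orbT.
have gaX : g a \in X by apply: sX; rewrite mem_head.
have gbX : g b \in X by apply: sX; rewrite !inE eqxx orbT.
have bl := path_lt_last bs.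
have tab := theta_mono aT bT ab.
have tbl : theta b <= theta (last b s).
  by move: bl; rewrite le_eqVlt => /predU1P [<-//|?]; apply/ltW/theta_mono.
have gab : theta (g b) - theta (g a) = c * (theta b - theta a).
  apply: theta_rel => //; [exact: subTX..|].
  by rewrite gc ?lexx ?ltW // addrC addKr.
have lin_fwd (p q r s' : int) : p + q * (r + 1 - s') - (p + q * (r - s')) = q by ring.
have lin_bwd (p q r s' : int) : p + q * (r - 1 - s') - (p + q * (r - s')) = - q by ring.
(* The first piece is prepended to the interpolation of the others; by [gab] the two agree at
   [theta b]. *)
pose F' (j : int) : int := if j <= theta b then theta (g a) + c * (j - theta a) else F j.
have F'l (j : int) : j <= theta b -> F' j = theta (g a) + c * (j - theta a).
  by rewrite /F' => ->.
have F'r (j : int) : theta b <= j -> F' j = F j.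
  rewrite le_eqVlt => /predU1P [<-|jb]; last by rewrite /F' leNgt jb.
  by rewrite F'l // -gab Fb; ring.
have F'incl j : j < theta b -> F' (j + 1) - F' j = c.
  by move=> jb; rewrite !F'l ?lezD1 ?lin_fwd // ltW.
have F'decl j : j <= theta b -> F' (j - 1) - F' j = - c.
  by move=> jb; rewrite !F'l ?lin_bwd // (le_trans _ jb) // gerBl.
have F'incr j : theta b <= j -> F' (j + 1) - F' j = F (j + 1) - F j.
  by move=> jb; rewrite !F'r // (le_trans jb) // lerDl.
have F'decr j : theta b < j -> F' (j - 1) - F' j = F (j - 1) - F j.
  by move=> jb; rewrite !F'r ?lerBrDr ?lezD1 // ltW.
have theta_le x y : x \in T -> y \in T -> x <= y -> theta x <= theta y.
  by move=> xT yT; rewrite le_eqVlt => /predU1P [->//|?]; apply/ltW/theta_mono.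
clearbody F'; exists F'; split.
- by rewrite F'l ?(ltW tab) // subrr mulr0 addr0.
- by rewrite F'r.
- move=> t tT /andP [at_ tl]; have [tb|bt] := ltP t b.
    exists c; last exact/F'incl/theta_mono.
    exists (b - t) => [|h /andP [h0 hb]]; first by rewrite subr_gt0.
    by rewrite (gc (t + h)) ?(gc t); [ring|lra|lra].
  by rewrite F'incr ?theta_le //; apply: Ffwd; rewrite ?bt.
- move=> t tT /andP [at_ tl]; have [tb|bt] := leP t b.
    exists (- c); last exact/F'decl/theta_le.
    exists (t - a) => [|h /andP [h0 hb]]; first by rewrite subr_gt0.
    by rewrite (gc (t - h)) ?(gc t) ?rmorphN /=; [ring|lra|lra].
  by rewrite F'decr ?theta_mono //; apply: Fbwd; rewrite ?bt.
(* Since [b] is in [T], [j] is not [theta b], the only place where the glued function may bend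
   anew. *)
- move=> j /andP [aj jl] jT; have := jT b bT; rewrite neq_lt => /orP [bj|jb].
    by rewrite F'incr ?(ltW bj) // F'decr //; apply: Flin; rewrite ?bj.
  by rewrite F'incl // F'decl ?(ltW jb) // subrr.
Qed.

End Interpolation.

End Slopes.

(** * Push-forward of divisors and functions to the subdivision *)

Section Discretization.
Variables (R : realType) (G : multigraph) (l : edge G -> R).
Hypothesis l_gt0 : forall e, 0 < l e.
Variables (theta : R -> int) (T : seq R).
Hypotheses (T0 : 0 \in T) (Tl : forall e, l e \in T) (theta0 : theta 0 = 0).
Hypothesis theta_mono : {in T &, {homo theta : x y / x < y}}.

Lemma theta_ltE : {in T &, forall x y, (theta x < theta y) = (x < y)}.
Proof.
move=> x y xT yT; case: (ltgtP x y) => [|yx|->]; last by rewrite ltxx.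
  exact: theta_mono.
by apply/negbTE; rewrite -leNgt ltW // theta_mono.
Qed.

Lemma theta_inj : {in T &, injective theta}.
Proof.
by move=> x y xT yT txy; case: (ltgtP x y) => //; rewrite -theta_ltE // txy ltxx.
Qed.

(** A path of integral length [theta (l e)] has one interior vertex fewer than edges. *)
Definition subdivision_size (e : edge G) : nat := `|theta (l e)|.-1.
Local Notation n := subdivision_size.
Local Notation pv := (path_vertex n).

Lemma subdivision_sizeE e : (n e).+1%:Z = theta (l e).
Proof.
have := theta_mono T0 (Tl e) (l_gt0 e); rewrite theta0 /subdivision_size; lia.
Qed.

Lemma theta_interior e t : t \in T -> 0 < t < l e -> (0 < `|theta t| < (n e).+1)%N.
Proof.
move=> tT; rewrite -!theta_ltE // theta0 -subdivision_sizeE; lia.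
Qed.

(** The value at a vertex is a default, harmless because 0 belongs to [T]. *)
Definition position (x : mpoint l) : R :=
  match x with inl _ => 0 | inr q => val (tagged q) end.

Definition vertex_of (x : mpoint l) : vert (subdivide n) :=
  match x with inl v => inl v | inr q => pv (tag q) `|theta (val (tagged q))| end.

Variable Y : seq (mpoint l).
Hypotheses (uniqY : uniq Y) (YT : forall x, x \in Y -> position x \in T).

(** Strict monotonicity keeps the image of an interior position strictly between 0 and
    [theta (l e)]. *)
Lemma vertex_of_eq_inl x v : x \in Y -> vertex_of x = inl v -> x = inl v.
Proof.
case: x => [w _ [->] //|[e [t tl]]] /YT /= tT /eqP.
have := theta_interior tT tl => /andP [t0 tn].
rewrite path_vertex_eq_inl; last exact: ltnW.
by rewrite (gtn_eqF t0) (ltn_eqF tn).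
Qed.

Lemma seg_interior e t (tl : 0 < t < l e) :
  seg l e t = inr (@Tagged _ e (fun e => {t : R | 0 < t < l e}) (exist _ t tl)).
Proof.
rewrite /seg; case: insubP => [u _ ut|]; last by rewrite tl.
by congr (inr (Tagged _ _)); apply: val_inj.
Qed.

Lemma vertex_of_seg e t : 0 < t < l e -> vertex_of (seg l e t) = pv e `|theta t|.
Proof. by move=> tl; rewrite (seg_interior tl). Qed.

Lemma vertex_of_inner x e k : x \in Y -> (0 < k < (n e).+1)%N ->
  vertex_of x = pv e k ->
  exists2 t, t \in T & [/\ 0 < t < l e, theta t = k & x = seg l e t].
Proof.
case: x => [v _ /andP [k0 kn] /esym/eqP|[e' [t tl]]].
  by rewrite path_vertex_eq_inl ?(gtn_eqF k0) ?(ltn_eqF kn) // ltnW.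
move=> /YT /= tT kn /eqP; have tn := theta_interior tT tl.
rewrite path_vertex_eq_inner //; last by lia.
move=> /andP [/eqP ee /eqP tk]; subst e'; exists t => //; split=> //; last by rewrite (seg_interior tl).
by rewrite -tk gez0_abs // -theta0 ltW // theta_ltE //; case/andP: tl.
Qed.

(** Summing over a fixed list [Y] instead of the support of [D] makes the push-forward additive in
    [D]. *)
Definition push (D : mdivisor l) : gdivisor (subdivide n) :=
  [ffun p => \sum_(x <- Y | vertex_of x == p) coeff x D].

Section Push.
Variable D : mdivisor l.
Hypothesis domY : {subset dom D <= Y}.

Lemma gdeg_push : gdeg (push D) = deg D.
Proof.
rewrite /gdeg; under eq_bigr do rewrite ffunE big_mkcond.
rewrite exchange_big /=.
under eq_bigr => x _.
  rewrite -big_mkcond (big_pred1 (vertex_of x)); last by move=> p; rewrite eq_sym.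
  over.
rewrite -[in RHS](freeg_sumE D) raddf_sum /=; under [RHS]eq_bigr do rewrite degU.
rewrite (bigID (mem (dom D))) /= [X in _ + X]big1 => [|x]; last exact: coeff_outdom.
rewrite addr0 -big_filter; apply/perm_big/uniq_perm; rewrite ?filter_uniq ?uniq_dom //.
by move=> x; rewrite mem_filter; case: (boolP (x \in dom D)) => //= /domY.
Qed.

(** If [x] is not in [Y], both sides are 0, because [Y] contains the support. *)
Lemma push_unique x p : (forall y, y \in Y -> vertex_of y = p -> y = x) ->
  vertex_of x = p -> push D p = coeff x D.
Proof.
move=> xu xp; rewrite ffunE; have [xY|xY] := boolP (x \in Y).
  rewrite big_mkcond (bigD1_seq x) //= xp eqxx big1_seq ?addr0 // => y /andP [yx yY].
  case: eqP => // yp; by rewrite (xu y yY yp) eqxx in yx.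
rewrite coeff_outdom; last by apply: contra xY; exact: domY.
rewrite big1_seq // => y /andP [/eqP yp yY].
by rewrite -(xu y yY yp) yY in xY.
Qed.

Lemma push_inl v : push D (inl v) = coeff (inl v) D.
Proof. by apply: push_unique => // y yY; exact: vertex_of_eq_inl. Qed.

Lemma push_seg e t : t \in T -> 0 < t < l e ->
  push D (pv e `|theta t|) = coeff (seg l e t) D.
Proof.
move=> tT tl; apply: push_unique => [y yY|]; last by rewrite vertex_of_seg.
case/(vertex_of_inner yY (theta_interior tT tl)) => t' t'T [t'l tt ->].
congr seg; apply: theta_inj => //; rewrite tt gez0_abs // -theta0 ltW // theta_ltE //.
by case/andP: tl.
Qed.

Lemma push_outside e k : (0 < k < (n e).+1)%N ->
  (forall t, t \in T -> theta t != k) -> push D (pv e k) = 0.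
Proof.
move=> kn kT; rewrite ffunE big1_seq // => x /andP [/eqP xk xY].
have [t tT [_ tk _]] := vertex_of_inner xY kn xk.
by have := kT t tT; rewrite tk eqxx.
Qed.

Lemma push_effective : meffective D -> geffective (push D).
Proof. by move=> D0 p; rewrite ffunE; apply: sumr_ge0 => x _; exact: D0. Qed.

End Push.

Definition discrete_function (v : vert G -> int) (F : edge G -> int -> int)
    (p : vert (subdivide n)) : int :=
  match p with inl w => v w | inr q => F (tag q) (tagged q).+1%:Z end.

Lemma discrete_functionE v F e k :
  F e 0 = v (src e) -> F e (theta (l e)) = v (tgt e) -> (k <= (n e).+1)%N ->
  discrete_function v F (pv e k) = F e k%:Z.
Proof.
move=> F0 Fl; case: k => [|k]; first by rewrite path_vertex_first F0.
rewrite ltnS leq_eqVlt => /predU1P [->|kn]; last by rewrite path_vertex_inner.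
by rewrite path_vertex_last /= subdivision_sizeE Fl.
Qed.

(** The Laplacian is minus the sum of outgoing increments. These equal the slopes of [f] at the
    points with position in [T]; at the other path vertices they cancel, and no chip is pushed
    there. *)
Lemma push_equiv (D E : mdivisor l) (f : mpoint l -> R) (v : vert G -> int)
    (F : edge G -> int -> int) :
  {subset dom D <= Y} -> {subset dom E <= Y} -> is_div f (D - E) ->
  (forall e, F e 0 = v (src e)) -> (forall e, F e (theta (l e)) = v (tgt e)) ->
  (forall e t, t \in T -> 0 <= t < l e -> exists2 c : int,
     right_slope (f \o seg l e) t c%:~R & F e (theta t + 1) - F e (theta t) = c) ->
  (forall e t, t \in T -> 0 < t <= l e -> exists2 c : int,
     left_slope (f \o seg l e) t c%:~R & F e (theta t - 1) - F e (theta t) = c) ->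
  (forall e j, 0 < j < theta (l e) -> (forall t, t \in T -> theta t != j) ->
     F e (j + 1) - F e j + (F e (j - 1) - F e j) = 0) ->
  gequiv (push D) (push E).
Proof.
move=> DY EY fDE F0 Fl Ffwd Fbwd Flin; apply/gequivP.
exists (discrete_function v F) => p.
have ext e k : (k <= (n e).+1)%N -> discrete_function v F (pv e k) = F e k%:Z.
  by move=> kn; rewrite discrete_functionE.
have DEY : {subset dom (D - E) <= Y}.
  by move=> x /domB; rewrite mem_cat => /orP [/DY|/EY].
suff : push (D - E) p = - lap (discrete_function v F) p.
  rewrite !ffunE; under eq_bigr do rewrite coeffB.
  by rewrite sumrB => <-; ring.
case: p => [w|[e k]].
  rewrite push_inl //; apply: (@intr_inj R); rewrite fDE lap_inl /= opprD -!sumrN.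
  rewrite rmorphD !rmorph_sum /=; congr (_ + _); apply: eq_bigr => e /eqP we.
    have [|c /slope_fwdE -> <-] := Ffwd e 0 T0; first by rewrite lexx l_gt0.
    by rewrite ext // theta0 F0 add0r we opprB.
  have [|c /slope_bwdE -> <-] := Fbwd e (l e) (Tl e); first by rewrite lexx l_gt0.
  rewrite ext // Fl we -subdivision_sizeE opprB; congr (F e _ - _)%:~R; lia.
have kn : (0 < k.+1 < (n e).+1)%N by rewrite /= ltnS ltn_ord.
have -> : inr (existT _ e k) = pv e k.+1 :> vert (subdivide n).
  by rewrite path_vertex_inner //; congr (inr (Tagged _ _)); apply: val_inj.
rewrite lap_inner // !ext //=; try lia.
have ->: k.+2%:Z = k.+1%:Z + 1 by lia.
have ->: k%:Z = k.+1%:Z - 1 by lia.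
rewrite [RHS](_ : _ = F e (k.+1%:Z + 1) - F e k.+1%:Z + (F e (k.+1%:Z - 1) - F e k.+1%:Z)); last by ring.
(* Either the path vertex comes from a position in [T], or both sides vanish. *)
have [[t tT tk]|noT] := pselect (exists2 t, t \in T & theta t = k.+1%:Z); last first.
  rewrite push_outside // => [|t tT]; last by apply/eqP => tk; apply: noT; exists t.
  rewrite Flin // => [|t tT]; last by apply/eqP => tk; apply: noT; exists t.
  by rewrite -subdivision_sizeE; lia.
have tl : 0 < t < l e.
  by rewrite -!theta_ltE // theta0 tk -subdivision_sizeE; lia.
have -> : pv e k.+1 = pv e `|theta t| by rewrite tk.
rewrite push_seg // -tk; apply: (@intr_inj R); rewrite fDE (seg_interior tl) /=.
have [|c /slope_fwdE -> <-] := Ffwd e t tT; first by lra.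
have [|c' /slope_bwdE -> <-] := Fbwd e t tT; first by lra.
by rewrite -rmorphD.
Qed.

End Discretization.

(** * Gonality of a subdivision bounded by the degree of a covering divisor *)

Section CoveringBound.
Variables (R : realType) (G : multigraph) (l : edge G -> R).
Hypothesis l_gt0 : forall e, 0 < l e.

Lemma seg_src e : seg l e 0 = inl (src e).
Proof. by rewrite /seg insubF ?ltxx // lexx. Qed.

Lemma seg_tgt e : seg l e (l e) = inl (tgt e).
Proof. by rewrite /seg insubF ?ltxx ?andbF // leNgt l_gt0. Qed.

(** By [positive_rank_subdivide] only the vertices of [G] have to be covered. This leaves finitely
    many functions, so a single [theta], hence a single subdivision, serves all of them. *)
Lemma gonality_subdivide_le_deg (D : mdivisor l) :
  (forall v, covers D (inl v)) ->
  exists n : edge G -> nat, gonality (subdivide n) <= deg D.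
Proof.
move=> Dcov.
have /choice [E EP] v : exists E : mdivisor l * (mpoint l -> R),
    [/\ meffective E.1, rational_function E.2, is_div E.2 (E.1 - D) & inl v \in dom E.1].
  by have [E [E0 [f fr fE] vE]] := Dcov v; exists (E, f).
have /choice [s sP] (q : vert G * edge G) : exists s, [/\ path <%R 0 s,
    last 0 s = l q.2 & linear_pieces ((E q.1).2 \o seg l q.2) 0 s].
  by have [_ [_ /(_ q.2) [s [s0 sl sp]]] _ _] := EP q.1; exists s.
(* [Y] collects all points carrying chips, [T] the edge lengths, chip positions and breakpoints, and
   [X] in addition the values of the functions at the breakpoints. *)
pose Y := undup (dom D ++ flatten [seq dom (E v).1 | v <- enum (vert G)]).
pose T := 0 :: [seq l e | e <- enum (edge G)] ++ map (@position R G l) Y ++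
  flatten [seq s q | q <- enum ((vert G * edge G)%type : finType)].
pose X := T ++ flatten [seq [seq (E q.1).2 (seg l q.2 t) | t <- 0 :: s q]
  | q <- enum ((vert G * edge G)%type : finType)].
have TX : {subset T <= X} by move=> t tT; rewrite mem_cat tT.
have T0 : 0 \in T by rewrite mem_head.
have Tl e : l e \in T by rewrite inE !mem_cat map_f ?orbT ?mem_enum.
have TY x : x \in Y -> position x \in T.
  by move=> xY; rewrite inE !mem_cat (map_f _ xY) !orbT.
have Ts q : {subset 0 :: s q <= T}.
  move=> t; rewrite inE => /predU1P [->//|ts]; rewrite inE !mem_cat.
  suff -> : t \in flatten [seq s q | q <- enum ((vert G * edge G)%type : finType)] by rewrite !orbT.
  by apply/flattenP; exists (s q) => //; rewrite map_f ?mem_enum.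
have Xs q : {subset map ((E q.1).2 \o seg l q.2) (0 :: s q) <= X}.
  move=> t ts; rewrite mem_cat; apply/orP; right; apply/flattenP.
  exists [seq (E q.1).2 (seg l q.2 t) | t <- 0 :: s q] => //.
  by apply/mapP; exists q; rewrite ?mem_enum.
have [theta1 [theta1_mono theta1_rel]] := integer_model X.
(* The order and the relations involve differences only, so the model may be shifted to fix 0. *)
pose theta x := theta1 x - theta1 0.
have theta0 : theta 0 = 0 by rewrite /theta subrr.
have theta_mono : {in T &, {homo theta : x y / x < y}}.
  by move=> x y xT yT xy; rewrite ltrD2r theta1_mono ?TX.
have theta_rel x y z w c : x \in X -> y \in X -> z \in X -> w \in X ->
    x - y = c%:~R * (z - w) -> theta x - theta y = c * (theta z - theta w).
  move=> xX yX zX wX rel; have := theta1_rel x y z w c xX yX zX wX rel.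
  rewrite /theta; have shift (a b d : int) : a - d - (b - d) = a - b by ring.
  by rewrite !shift.
have /choice [F FP] (q : vert G * edge G) := discrete_interpolation TX theta_mono theta_rel
  (let: And3 p _ _ := sP q in p) (let: And3 _ _ p := sP q in p) (@Ts q) (@Xs q).
exists (subdivision_size l theta).
pose n := subdivision_size l theta.
have YD : {subset dom D <= Y} by move=> x xD; rewrite mem_undup mem_cat xD.
have YE v : {subset dom (E v).1 <= Y}.
  move=> x xE; rewrite mem_undup mem_cat; apply/orP; right.
  by apply/flattenP; exists (dom (E v).1) => //; apply/mapP; exists v; rewrite ?mem_enum.
have uY : uniq Y by exact: undup_uniq.
rewrite -(gdeg_push theta uY YD); apply: gonality_le.
apply: positive_rank_subdivide => v; exists (push theta Y (E v).1).
have [E0 _ fE vE] := EP v.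
split.
- exact: push_effective.
- apply: (@push_equiv R G l l_gt0 theta T T0 Tl theta0 theta_mono Y uY TY
    (E v).1 D (E v).2 (fun w => theta ((E v).2 (inl w))) (fun e => F (v, e))) => //.
  + by move=> e; have [+ _ _ _ _] := FP (v, e); rewrite theta0 /= seg_src.
  + move=> e; have [_ + _ _ _] := FP (v, e); have [_ -> _] := sP (v, e).
    by rewrite /= seg_tgt.
  + move=> e t tT tl; have [_ _ + _ _] := FP (v, e); have [_ -> _] := sP (v, e).
    exact.
  + move=> e t tT tl; have [_ _ _ + _] := FP (v, e); have [_ -> _] := sP (v, e).
    exact.
  + move=> e j jl jT; have [_ _ _ _] := FP (v, e); have [_ -> _] := sP (v, e).
    by rewrite theta0; apply.
- rewrite (@push_inl R G l l_gt0 theta T) //.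
  by move: vE; rewrite mem_dom -gtz0_ge1 lt_def => ->; exact: E0.
Qed.

End CoveringBound.

(** * A divisor that covers every point of the metric graph *)

Section CoveringDivisor.
Variables (R : realType) (G : multigraph) (l : edge G -> R).
Hypothesis l_gt0 : forall e, 0 < l e.

Lemma mwalk_lipschitz (f : mpoint l -> R) (k : R) :
  (forall e s t, 0 <= s <= l e -> 0 <= t <= l e ->
     `|f (seg l e s) - f (seg l e t)| <= k * `|s - t|) ->
  forall x y L, mwalk x y L -> `|f x - f y| <= k * L.
Proof.
move=> fk x y L; elim=> {x y L} [x|e s t y L hs ht _ IH].
  by rewrite subrr normr0 mulr0.
rewrite mulrDr -[X in X - f y](subrK (f (seg l e t))) -addrA.
by apply: (le_trans (ler_normD _ _)); rewrite lerD ?fk.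
Qed.

(** Balls are defined by lengths of walks, and Lipschitz bounds on the segments add up along a
    walk. *)
Lemma lipschitz_continuous (f : mpoint l -> R) (k : R) : 0 < k ->
  (forall e s t, 0 <= s <= l e -> 0 <= t <= l e ->
     `|f (seg l e s) - f (seg l e t)| <= k * `|s - t|) ->
  continuous f.
Proof.
move=> k0 fk x; have nF := nbhs_filter x; apply/cvgrPdist_lt => eps eps0.
apply: (proj2 (@nbhs_ballP R (mpoint l) x _)).
exists (eps / k) => /=; first by rewrite divr_gt0.
move=> y [L w Lk]; apply: (le_lt_trans (mwalk_lipschitz fk w)).
by rewrite mulrC -ltr_pdivlMr.
Qed.

Lemma segP (x : mpoint l) :
  (exists v, x = inl v) \/ exists e t, 0 < t < l e /\ x = seg l e t.
Proof.
case: x => [v|[e [t tl]]]; [by left; exists v|right; exists e, t].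
by rewrite (seg_interior tl).
Qed.

(** This divisor will witness that the set minimised in [metric_gonality] is not empty. *)
Definition vertex_divisor : mdivisor l := \sum_v << (inl v : mpoint l) >>.

Lemma max0P (t : R) : t <= 0 /\ Num.max t 0 = 0 \/ 0 <= t /\ Num.max t 0 = t.
Proof.
by have [t0|/ltW t0] := leP t 0; [left|right]; split.
Qed.

(** * Moving a chip inwards from each end of an edge *)

Section Bump.
Variables (e0 : edge G) (a : R).
Hypotheses (a_gt0 : 0 < a) (a_le : a <= l e0 - a).
Let b := l e0 - a.

(* Slope -1 on [0, a], constant on [a, b], slope 1 on [b, l e0]: adding its
   divisor moves one chip from each end of [e0] to the distance [a] from that
   end. *)
Definition trough (t : R) : R := - t + Num.max (t - a) 0 + Num.max (t - b) 0.

Definition trough_function (x : mpoint l) : R :=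
  match x with
  | inl _ => 0
  | inr q => if tag q == e0 then trough (val (tagged q)) else 0
  end.

Lemma trough0 : trough 0 = 0.
Proof.
have ag := a_gt0; have al := a_le; have bE : b = l e0 - a by [].
by rewrite /trough !max_r; lra.
Qed.

Lemma troughl : trough (l e0) = 0.
Proof.
have ag := a_gt0; have al := a_le; have bE : b = l e0 - a by [].
by rewrite /trough !max_l; lra.
Qed.

Lemma trough_functionE e t : 0 <= t <= l e ->
  trough_function (seg l e t) = if e == e0 then trough t else 0.
Proof.
move=> /andP [t0 tl].
have [t00|t00] := eqVneq t 0.
  by rewrite t00 seg_src trough0 /=; case: ifP.
have [tll|tll] := eqVneq t (l e).
  rewrite tll seg_tgt //=; case: eqP => // ->; by rewrite troughl.
by rewrite seg_interior // !lt_neqAle eq_sym t00 t0 tll.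
Qed.

(** A kink already affects the right slope at the kink itself, hence the weak inequalities; the left
    slope changes only beyond it. *)
Lemma trough_right_slope t : right_slope trough t
  (- 1 + (a <= t)%R%:R + (b <= t)%R%:R).
Proof.
have one c : exists2 d : R, 0 < d & forall h, 0 <= h <= d ->
    Num.max (t + h - c) 0 = Num.max (t - c) 0 + (c <= t)%R%:R * h.
  have [ct|tc] := leP c t.
    by exists 1 => // h hh; rewrite !max_l ?mul1r; lra.
  by exists (c - t) => [|h hh]; [lra|rewrite !max_r ?mul0r; lra].
have [d d0 hd] := one a; have [d' d'0 hd'] := one b.
exists (Num.min d d'); first by rewrite lt_min d0.
move=> h; rewrite le_min => /and3P [h0 h1 h2].
by rewrite /trough hd ?h0 // hd' ?h0 //; ring.
Qed.

Lemma trough_left_slope t : left_slope trough t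
  (1 - (a < t)%R%:R - (b < t)%R%:R).
Proof.
have one c : exists2 d : R, 0 < d & forall h, 0 <= h <= d ->
    Num.max (t - h - c) 0 = Num.max (t - c) 0 - (c < t)%R%:R * h.
  have [ct|tc] := ltP c t.
    by exists (t - c) => [|h hh]; [lra|rewrite !max_l ?mul1r; lra].
  by exists 1 => // h hh; rewrite !max_r ?mul0r; lra.
have [d d0 hd] := one a; have [d' d'0 hd'] := one b.
exists (Num.min d d'); first by rewrite lt_min d0.
move=> h; rewrite le_min => /and3P [h0 h1 h2].
by rewrite /trough hd ?h0 // hd' ?h0 //; ring.
Qed.

Lemma trough_pl g : (forall t, 0 <= t <= l e0 -> g t = trough t) ->
  pl_integral g 0 (l e0).
Proof.
move=> gE; have ag := a_gt0; have al := a_le; have bE : b = l e0 - a by [].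
have tl x : 0 <= x <= a -> g x = - x.
  move=> xa; rewrite gE /trough; last lra.
  by case: (max0P (x - a)) => -[? ->]; case: (max0P (x - b)) => -[? ->]; lra.
have tm x : a <= x <= b -> g x = - a.
  move=> xa; rewrite gE /trough; last lra.
  by case: (max0P (x - a)) => -[? ->]; case: (max0P (x - b)) => -[? ->]; lra.
have tr x : b <= x <= l e0 -> g x = x - l e0.
  move=> xa; rewrite gE /trough; last lra.
  by case: (max0P (x - a)) => -[? ->]; case: (max0P (x - b)) => -[? ->]; lra.
(* Breakpoints must increase strictly, so the constant piece is dropped when [a = b]. *)
have [ab|ab] := ltP a b.
  exists [:: a; b; l e0]; split=> [||[|[|[|//]]] _] /=.
  - by rewrite a_gt0 ab; lra.
  - by [].
  - by exists (-1) => t ht; rewrite !tl ?rmorphN /=; lra.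
  - by exists 0 => t ht; rewrite mulr0z mul0r addr0 !tm ?lexx ?(ltW ab).
  - by exists 1 => t ht; rewrite !tr; lra.
have {}ab : a = b by apply/le_anti; rewrite ab a_le.
exists [:: a; l e0]; split=> [||[|[|//]] _] /=.
- by rewrite a_gt0; lra.
- by [].
- by exists (-1) => t ht; rewrite !tl ?rmorphN /=; lra.
- by exists 1 => t ht; rewrite !tr; lra.
Qed.

Lemma trough_rational : rational_function trough_function.
Proof.
split=> [|e].
  (* The Lipschitz constant 3 allows 1 for each of the three summands of [trough]. *)
  have k0 : 0 < 1 + 1 + 1 :> R by lra.
  apply: (lipschitz_continuous k0) => e s t hs ht.
  rewrite !trough_functionE //; case: eqP => _; last first.
    by rewrite subrr normr0 mulr_ge0 ?(ltW k0).
  have max_lip c : `|Num.max (s - c) 0 - Num.max (t - c) 0| <= `|s - t|.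
    have [st|st] := lerP s t; rewrite ler_norml; apply/andP;
    case: (max0P (s - c)) => -[? ->]; case: (max0P (t - c)) => -[? ->]; split; lra.
  have -> : trough s - trough t = (t - s) + (Num.max (s - a) 0 - Num.max (t - a) 0)
      + (Num.max (s - b) 0 - Num.max (t - b) 0) by rewrite /trough; ring.
  rewrite !mulrDl !mul1r.
  apply: (le_trans (ler_normD _ _)); rewrite lerD // (le_trans (ler_normD _ _)) //.
  by rewrite lerD // distrC.
have [->|ee] := eqVneq e e0.
  by apply: trough_pl => t ht; rewrite /= trough_functionE // eqxx.
have fE t : 0 <= t <= l e -> trough_function (seg l e t) = 0.
  by move=> ht; rewrite trough_functionE // (negPf ee).
exists [:: l e]; split=> [||[|//] _] /=; rewrite ?l_gt0 //.
by exists 0 => t ht; rewrite mulr0z mul0r addr0 !fE // lexx ltW.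
Qed.

Lemma slope_fwd_trough e t : 0 <= t < l e ->
  slope_fwd trough_function e t =
  if e == e0 then - 1 + (a <= t)%R%:R + (b <= t)%R%:R else 0.
Proof.
move=> tl; apply: slope_fwdE.
apply: (right_slope_ext tl) => [s hs|]; first by rewrite /= trough_functionE //.
case: ifP => _; first exact: trough_right_slope.
by exists 1 => // h _; rewrite mul0r addr0.
Qed.

Lemma slope_bwd_trough e t : 0 < t <= l e ->
  slope_bwd trough_function e t =
  if e == e0 then 1 - (a < t)%R%:R - (b < t)%R%:R else 0.
Proof.
move=> tl; apply: slope_bwdE.
apply: (left_slope_ext tl) => [s hs|]; first by rewrite /= trough_functionE //.
case: ifP => _; first exact: trough_left_slope.
by exists 1 => // h _; rewrite mul0r addr0.
Qed.

Definition trough_divisor : mdivisor l :=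
  << seg l e0 a >> + << seg l e0 b >>
  - << (inl (src e0) : mpoint l) >> - << (inl (tgt e0) : mpoint l) >>.

Let ab_interior : 0 < a < l e0 /\ 0 < b < l e0.
Proof. have ag := a_gt0; have al := a_le; have bE : b = l e0 - a by []. lra. Qed.

Lemma seg_eq_inl e t v : 0 < t < l e -> (seg l e t == inl v) = false.
Proof. by move=> tl; rewrite (seg_interior tl). Qed.

Lemma seg_eq e e' t t' : 0 < t < l e -> 0 < t' < l e' ->
  (seg l e t == seg l e' t') = (e == e') && (t == t').
Proof.
move=> tl tl'; apply/eqP/andP => [|[/eqP -> /eqP -> //]].
(* Passing to a non-dependent pair avoids inverting an equality of dependent pairs. *)
pose coordinates (x : mpoint l) : option (edge G * R) :=
  match x with inl _ => None | inr q => Some (tag q, val (tagged q)) end.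
rewrite (seg_interior tl) (seg_interior tl') => /(congr1 coordinates) /=.
by case=> -> ->.
Qed.

Lemma coeff_trough_inl v :
  coeff (inl v) trough_divisor = - (src e0 == v)%:R - (tgt e0 == v)%:R.
Proof.
have [al bl] := ab_interior.
rewrite !(coeffB, coeffD) !coeffU !mul1r !seg_eq_inl // !add0r.
by rewrite !(inj_eq (@inl_inj _ _)).
Qed.

Lemma coeff_trough_seg e t : 0 < t < l e ->
  coeff (seg l e t) trough_divisor = (e0 == e)%:R * ((a == t)%:R + (b == t)%:R).
Proof.
have [al bl] := ab_interior; move=> tl.
rewrite !(coeffB, coeffD) !coeffU !mul1r !seg_eq //.
rewrite ![inl _ == _]eq_sym !seg_eq_inl // !subr0 -!mulnb !natrM.
by rewrite mulrDr.
Qed.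

Lemma trough_is_div : is_div trough_function trough_divisor.
Proof.
have [/andP [a0 al] /andP [b0 bl]] := ab_interior.
move=> x; have [[v ->]|[e [t [tl ->]]]] := segP x.
  rewrite coeff_trough_inl /=.
  have sum_one (P : pred (edge G)) (F : edge G -> R) c :
      (forall e, F e = if e == e0 then c else 0) -> \sum_(e | P e) F e = (P e0)%:R * c.
    move=> FE; rewrite big_mkcond (bigD1 e0) //= big1 => [|e ee]; rewrite FE.
      by rewrite eqxx addr0; case: (P e0); rewrite ?mul1r ?mul0r.
    by rewrite (negPf ee); case: (P e).
  rewrite (sum_one (fun e => src e == v) _ (-1)) => [|e]; last first.
    by rewrite slope_fwd_trough ?lexx ?l_gt0 // (leNgt a) a0 (leNgt b) b0 !addr0.
  rewrite (sum_one (fun e => tgt e == v) _ (-1)) => [|e]; last first.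
    rewrite slope_bwd_trough ?lexx ?l_gt0 //; case: eqP => // ->.
    by rewrite al bl subrr sub0r.
  by rewrite !mulrN1 rmorphB rmorphN /= !rmorph_nat.
rewrite coeff_trough_seg // (seg_interior tl) /= eq_sym.
have /andP [t0 tl'] := tl.
rewrite slope_fwd_trough ?(ltW t0) // slope_bwd_trough ?t0 ?(ltW tl') //.
case: eqP => _; last by rewrite mul0r addr0.
rewrite mul1r rmorphD /= !rmorph_nat.
by case: (ltgtP a t) => _; case: (ltgtP b t) => _ /=; ring.
Qed.

End Bump.

Lemma coeff_vertex_divisor_inl v : coeff (inl v) vertex_divisor = 1.
Proof.
rewrite /vertex_divisor raddf_sum /= (bigD1 v) //= coeffU eqxx mul1r big1 ?addr0 //.
by move=> u uv; rewrite coeffU (inj_eq (@inl_inj _ _)) (negPf uv) mulr0.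
Qed.

Lemma coeff_vertex_divisor_seg e t : 0 < t < l e ->
  coeff (seg l e t) vertex_divisor = 0.
Proof.
move=> tl; rewrite /vertex_divisor raddf_sum /= big1 // => u _.
by rewrite coeffU eq_sym seg_eq_inl // mulr0.
Qed.

Lemma covers_support (D : mdivisor l) x : meffective D -> x \in dom D -> covers D x.
Proof.
move=> D0 xD; exists D; split=> //; exists (fun=> 0).
  split=> [|e]; first exact: cst_continuous.
  exists [:: l e]; split=> [||[|//] _] /=; rewrite ?l_gt0 //.
  by exists 0 => t _; rewrite mulr0z mul0r addr0.
have rs e t : slope_fwd (fun _ : mpoint l => 0 : R) e t = 0.
  by apply: slope_fwdE; exists 1 => // h _; rewrite /= mul0r addr0.
have ls e t : slope_bwd (fun _ : mpoint l => 0 : R) e t = 0.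
  by apply: slope_bwdE; exists 1 => // h _; rewrite /= mul0r addr0.
move=> y; rewrite subrr coeff0; case: y => [v|q] /=; last by rewrite rs ls addr0.
by rewrite !big1 ?addr0.
Qed.

Lemma vertex_divisor_covers x : covers vertex_divisor x.
Proof.
have [[v ->]|[e [t [tl ->]]]] := segP x.
  apply: covers_support; last by rewrite mem_dom coeff_vertex_divisor_inl.
  move=> y; have [[u ->]|[e [t [tl ->]]]] := segP y.
    by rewrite coeff_vertex_divisor_inl.
  by rewrite coeff_vertex_divisor_seg.
(* The distance to the nearer end: then [t] is one of the two points at distance [a] from an end of
   [e]. *)
pose a := Num.min t (l e - t).
have aE : a = t \/ a = l e - t by rewrite /a; case: ltP; [left|right].
have a0 : 0 < a by rewrite lt_min subr_gt0.
have al : a <= l e - a.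
  have at_ : a <= t by rewrite ge_min lexx.
  have alt : a <= l e - t by rewrite ge_min lexx orbT.
  lra.
have coeff_sum y : coeff y (vertex_divisor + trough_divisor e a) =
  coeff y vertex_divisor + coeff y (trough_divisor e a) by rewrite coeffD.
exists (vertex_divisor + trough_divisor e a); split.
- move=> y; rewrite coeff_sum; have [[u ->]|[e' [t' [tl' ->]]]] := segP y.
    rewrite coeff_vertex_divisor_inl coeff_trough_inl //.
    (* The ends of [e] are distinct, so no vertex gives up more than its single chip. *)
    have := src_neq_tgt e; case: (src e =P u) => [->|_]; case: (tgt e =P u) => [->|_];
      by rewrite ?eqxx // ?oppr0 ?addr0 ?subrr.
  by rewrite coeff_vertex_divisor_seg // coeff_trough_seg // add0r mulr_ge0 ?addr_ge0.
- exists (trough_function e a); first exact: trough_rational.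
  by rewrite addrC addKr; exact: trough_is_div.
- rewrite mem_dom coeff_sum coeff_vertex_divisor_seg // coeff_trough_seg // eqxx.
  rewrite add0r mul1r; case: aE => ->; rewrite ?subKr eqxx;
    by case: (l e - t == t).
Qed.

End CoveringDivisor.

Theorem theorem4p1 (R : realType) (G : multigraph) (l : edge G -> R) :
  connected_graph G ->
  (forall e : edge G, 0 < l e) ->
  exists n : edge G -> nat, gonality (subdivide n) <= metric_gonality l.
Proof.
move=> _ l_gt0.
pose S : set int := [set d | exists2 D : mdivisor l, forall x, covers D x & deg D = d].
have [||[D Dcov degD] _] := @min_intP S (deg (vertex_divisor l)).
- by exists (vertex_divisor l) => // x; exact: vertex_divisor_covers.
- move=> _ [D Dcov <-].
  (* Degrees of covering divisors are nonnegative because each bounds the gonality of some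
     subdivision. *)
  have [n gn] := gonality_subdivide_le_deg l_gt0 (fun v => Dcov (inl v)).
  exact: le_trans (gonality_ge0 _) gn.
have [n gn] := gonality_subdivide_le_deg l_gt0 (fun v => Dcov (inl v)).
by exists n; rewrite /metric_gonality -/S -degD.
Qed.
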